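(* Let $(\mathcal Q,d)$ be a metric space, and write $\overline{qp}:=d(q,p)$. Let $q,p,y,z\in\mathcal Q$ and $a\in[\frac12,1]$. Assume $$\overline{yq}^{2}-\overline{yp}^{2}-\overline{zq}^{2}+\overline{zp}^{2}\le2\,\overline{yz}\,\overline{qp}.$$ Then $$\overline{yq}^{2a}-\overline{yp}^{2a}-\overline{zq}^{2a}+\overline{zp}^{2a}\le8a\,2^{-2a}\,\overline{yz}^{2a-1}\,\overline{qp}.$$
   Context: Powers are real powers of nonnegative reals. The hypothesis is only assumed for the four given points. *)

(* Defs.v *)
From mathcomp Require Export all_boot all_order all_algebra.
From mathcomp Require Export all_classical all_reals all_analysis.

Set Implicit Arguments.
Unset Strict Implicit.
Unset Printing Implicit Defensive.

(* [a `^ x] is [powR a x], with 0 `^ 0 = 1 and 0 `^ x = 0 for x != 0. *)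

(* Main.v *)
Require Import Defs.
From mathcomp Require Import all_boot all_order all_algebra.
From mathcomp Require Import all_classical all_reals all_analysis.
From mathcomp Require Import ring lra.

(** Write [f x = x^(1+c)] with [c = 2a-1] in [[0,1]], and let [A, B, C, D] be
    the distances yq, yp, zq, zp, while [b = yz] and [s = qp].  The claim is
    a statement about six real numbers: [f A - f B - f C + f D] is at most
    [2 (1+c) s (b/2)^c = 2 s f'(b/2)], where the triangle inequality gives
    [|A-B|, |D-C| <= s] and [|A-C|, |D-B| <= b].

    The derivative [f'] is concave, hence lies below its tangent at [b/2].
    Integrating that tangent gives a quadratic primitive [L] whose increments
    dominate those of [f] ([powR_le_tangent_primitive]).  For [L] itself the
    mixed difference is a combination, with nonnegative coefficients, of
    [A-B-C+D <= 2s] and of [A^2-B^2-C^2+D^2 <= 2bs], and replacing both by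
    their bounds gives exactly [2 s f'(b/2)] ([tangent_budget]).  So the
    theorem follows whenever the mixed difference of [f] is controlled by that
    of [L].  The order of the four numbers decides how this is done.

    - If [B <= A] and [C <= D], or [C <= A] and [B <= D], the comparison is
      immediate ([aligned_bound]).
    - If [A] and [D] are the extreme values, split off a second difference
      of [f], bounded through the subadditivity of [f']
      ([outer_positive_bound]).
    - If [B] and [C] are the extreme values, the mixed difference is
      an increment of [f] minus a second difference of [f], and the hypothesis
      on squares only controls the increment up to the product of the steps
      of that second difference.  Here the second difference itself has
      to pay for that product, which it does when [s <= b]
      ([outer_negative_bound], [outer_negative_core]).

    The hypotheses are symmetric under exchanging the pairs [(y,z)] and
    [(q,p)], and the bound for [s > b] follows from the exchanged one since
    [b (s/2)^c <= s (b/2)^c]; this is why [s <= b] may be assumed. *)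

Set Implicit Arguments.
Unset Strict Implicit.

Import Order.TTheory GRing.Theory Num.Theory.
Import numFieldNormedType.Exports.
Local Open Scope classical_set_scope.
Local Open Scope ring_scope.

(** * Elementary inequalities for real powers *)

Lemma gt0_mulr_powRB1 (R : realType) (x c : R) : 0 < x -> x * x `^ (c - 1) = x `^ c.
Proof.
move=> x0; rewrite -{1}(powRr1 (ltW x0)) -powRD ?(gt_eqF x0) ?implybT//.
by congr powR; ring.
Qed.

Lemma le0_ger_powR (R : realType) (e x y : R) : e <= 0 -> 0 < x -> x <= y ->
  y `^ e <= x `^ e.
Proof.
move=> e0 x0 xy; rewrite -[e]opprK !(powRN _ (- e)) lef_pV2.
- by apply: ge0_ler_powR; rewrite ?nnegrE; lra.
- by rewrite posrE powR_gt0; lra.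
- by rewrite posrE powR_gt0; lra.
Qed.

(** The concave function [x^c] lies below its tangents: after scaling to the
    point 1 this is Young's inequality for [t^c * 1]. *)
Lemma powR_tangent (R : realType) (c x y : R) : 0 <= c <= 1 -> 0 < x -> 0 <= y ->
  y `^ c <= x `^ c + c * x `^ (c - 1) * (y - x).
Proof.
move=> /andP[c0 c1] x0 y0.
have key (t : R) : 0 <= t -> t `^ c <= 1 + c * (t - 1).
  move=> t0.
  have [->|cn0] := eqVneq c 0; first by rewrite powRr0; lra.
  have [->|cn1] := eqVneq c 1; first by rewrite powRr1//; lra.
  have cgt0 : 0 < c by rewrite lt_def cn0.
  have clt1 : 0 < 1 - c by rewrite subr_gt0 lt_neqAle cn1.
  have := @conjugate_powR _ (t `^ c) 1 c^-1 (1 - c)^-1 (powR_ge0 _ _) ler01.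
  rewrite !invr_gt0 !invrK -powRrM divff// powRr1// powR1 mulr1.
  by move=> /(_ cgt0 clt1 (subrKC _ _)) h; apply: (le_trans h); lra.
have /(ler_wpM2r (powR_ge0 x c)) := key (y / x) (divr_ge0 y0 (ltW x0)).
rewrite -powRM ?divr_ge0// ?(ltW x0)// divfK ?gt_eqF// => h.
apply: (le_trans h); rewrite -(gt0_mulr_powRB1 c x0) le_eqVlt; apply/orP; left.
by apply/eqP; field; rewrite gt_eqF.
Qed.

Lemma powR_subadditive (R : realType) (c x y : R) : 0 <= c <= 1 -> 0 < x -> 0 <= y ->
  (y + x) `^ c <= y `^ c + x `^ c.
Proof.
move=> /andP[c0 c1] x0; rewrite le_eqVlt => /predU1P[<-|y0].
  by rewrite add0r lerDr powR_ge0.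
have yx0 : 0 < y + x by lra.
rewrite -(gt0_mulr_powRB1 c yx0) mulrDl -(gt0_mulr_powRB1 c y0) -(gt0_mulr_powRB1 c x0).
by apply: lerD; apply: ler_wpM2l; try apply: le0_ger_powR; lra.
Qed.

Lemma ln_ge1BV (R : realType) (x : R) : 0 < x -> 1 - x^-1 <= ln x.
Proof.
move=> x0; have xV0 : 0 < x^-1 by rewrite invr_gt0.
have := @le_ln1Dx _ (x^-1 - 1); rewrite subrKC lnV ?posrE// => h.
have : - ln x <= x^-1 - 1 by apply: h; lra.
lra.
Qed.

Lemma powR_ge1Dln (R : realType) (x e : R) : 0 < x -> 1 + e * ln x <= x `^ e.
Proof. by move=> x0; rewrite /powR gt_eqF// expR_ge1Dx. Qed.

(** Tangent of the convex function [y^(-e)] at [x]. *)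
Lemma powR_ratio_ge (R : realType) (e x y : R) : 0 <= e -> 0 < x -> 0 < y ->
  x `^ (- e) * (1 - e * (y / x - 1)) <= y `^ (- e).
Proof.
move=> e0 x0 y0; have yx0 : 0 < y / x by rewrite divr_gt0.
have -> : y `^ (- e) = x `^ (- e) * (y / x) `^ (- e).
  by rewrite -powRM ?(ltW x0) ?(ltW yx0)// mulrC divfK ?gt_eqF.
apply: ler_wpM2l; first exact: powR_ge0.
apply: le_trans (powR_ge1Dln _ yx0).
have := @le_ln1Dx _ (y / x - 1); rewrite subrKC => h.
have : e * ln (y / x) <= e * (y / x - 1) by apply: ler_wpM2l => //; apply: h; lra.
lra.
Qed.

(** The logarithmic form, at first order in [e], of the numerical inequality
    [powR_double_ge]; the bound [ln x >= 1 - 1/x] suffices up to [r = 2], and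
    beyond that point [ln (2r) >= 2 ln 2 >= 1]. *)
Lemma ln_double_ge (R : realType) (r : R) : 1 <= r ->
  1 - 2 / (r * (r + 1)) <= ln (2 * r).
Proof.
move=> r1; have r0 : 0 < r by lra.
have r10 : 0 < r + 1 by lra.
have [r2|r2] := leP r 2.
  apply: le_trans (ln_ge1BV _); last by lra.
  suff : (2 * r)^-1 <= 2 / (r * (r + 1)) by lra.
  rewrite ler_pdivlMr ?mulr_gt0// ler_pdivrMl ?mulr_gt0//; nra.
have p0 : 0 <= 2 / (r * (r + 1)) by rewrite divr_ge0// mulr_ge0; lra.
have : 1 <= ln (2 * r); last by lra.
have l2 := @ln_ge1BV R 2 (ltr0n _ 2).
have -> : 2 * r = 2 * 2 * (r / 2) by field.
rewrite (@lnM _ (2 * 2)) ?posrE; [|by lra|by lra].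
rewrite (@lnM _ 2) ?posrE; [|by lra|by lra].
have : 0 <= ln (r / 2) by apply: ln_ge0; lra.
lra.
Qed.

Lemma powR_double_ge (R : realType) (r e : R) : 1 <= r -> 0 <= e ->
  1 + e * (1 - 2 / (r * (r + 1))) <= (2 * r) `^ e.
Proof.
move=> r1 e0; apply: le_trans (powR_ge1Dln _ _); last by lra.
by rewrite lerD2l ler_wpM2l// ln_double_ge.
Qed.

(** * Comparing increments of a power *)

Lemma continuous_powR_shift (R : realType) (k al x0 : R) : 0 < x0 + k ->
  {for x0, continuous (fun x => (x + k) `^ al)}.
Proof.
move=> xk; apply: (@continuous_comp _ _ _ (fun x => x + k) (fun y => y `^ al)).
  by apply: cvgD; [exact: cvg_id|exact: cvg_cst].
have [/derivable1_diffP /differentiable_continuous + _] := is_derive1_powR al xk.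
exact.
Qed.

(** For [k = 0] only the one-sided limit holds, as [x `^ al = 1] for
    negative [x]. *)
Lemma cvg_powR_shift_right (R : realType) (k al : R) : 0 <= k -> 0 < al ->
  (x + k) `^ al @[x --> 0^'+] --> (0 + k) `^ al.
Proof.
rewrite le_eqVlt => /predU1P[<- al0|k0 al0].
  rewrite addr0 powR0 ?gt_eqF//; under eq_fun do rewrite addr0.
  exact: powR_cvg0.
apply: cvg_at_right_filter; apply: continuous_powR_shift; lra.
Qed.

(** Every comparison of increments of [x^(1+c)] below is the monotonicity of
    a combination of this form, read off from the sign of its derivative.  The endpoint [x = 0] is included by one-sided
    continuity, because distances may vanish. *)
Lemma powR_comb_le (R : realType) (k c p r u v h : R) : 0 <= k -> 0 <= c ->
  (forall x : R, 0 < x < h ->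
    0 <= (1 + c) * (p * (x + k) `^ c + r * x `^ c) + u + v * x) ->
  forall x y : R, 0 <= x -> x <= y -> y <= h ->
  p * (x + k) `^ (1 + c) + r * x `^ (1 + c) + u * x + v / 2 * x ^+ 2 <=
  p * (y + k) `^ (1 + c) + r * y `^ (1 + c) + u * y + v / 2 * y ^+ 2.
Proof.
move=> k0 c0 dg0 x y x0 xy yh.
have [h0|h0] := leP h 0.
  by have -> : x = y by apply/eqP; rewrite eq_le xy; lra.
pose g x := p * (x + k) `^ (1 + c) + r * x `^ (1 + c) + u * x + v / 2 * x ^+ 2.
pose dg x := (1 + c) * (p * (x + k) `^ c + r * x `^ c) + u + v * x.
have c10 : 0 < 1 + c by lra.
have itvP0h z : z \in `]0, h[ -> 0 < z < h by rewrite in_itv.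
have Dg z : z \in `]0, h[ -> is_derive z 1 g (dg z).
  move=> /itvP0h /andP[z0 _]; have zk0 : 0 < z + k by lra.
  have Dz := is_derive1_powR (1 + c) z0.
  have Dzk : is_derive z 1 (fun x => (x + k) `^ (1 + c)) ((1 + c) * (z + k) `^ c).
    have -> : (1 + c) * (z + k) `^ c = (1 + c) * (z + k) `^ (1 + c - 1) * 1.
      by rewrite mulr1 addrAC subrr add0r.
    apply: (@is_derive1_comp R (fun y => y `^ (1 + c)) (fun x => x + k)).
      exact: is_derive1_powR.
    by rewrite -[X in is_derive _ _ _ X](addr0 1); apply: is_deriveD.
  rewrite addrAC subrr add0r in Dz.
  by apply: is_derive_eq; rewrite /dg /GRing.scale /=; field.
have cvg_g (F : set_system R) (FF : Filter F) (z : R) : x @[x --> F] --> z ->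
    (x + k) `^ (1 + c) @[x --> F] --> (z + k) `^ (1 + c) ->
    (x + 0) `^ (1 + c) @[x --> F] --> (z + 0) `^ (1 + c) ->
    g x @[x --> F] --> g z.
  rewrite addr0 => Fz Fzk; under eq_fun do rewrite addr0.
  move=> Fz0; have cM q (w : R -> R) l : w x @[x --> F] --> l ->
      q * w x @[x --> F] --> q * l by move=> ?; apply: cvgM => //; exact: cvg_cst.
  apply: cvgD; last by apply: cM; under eq_fun do rewrite expr2; exact: cvgM.
  by apply: cvgD; [apply: cvgD|]; apply: cM.
apply: (@ger0_derive1_le_cc _ g 0 h) => //.
- by move=> z /Dg[].
- by move=> z zh; have [_ d] := Dg _ zh; rewrite derive1E d; exact/dg0/itvP0h.
- apply/continuous_within_itvP => //; split.
  + by move=> z /Dg[/derivable1_diffP /differentiable_continuous].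
  + apply: cvg_g; [|exact: cvg_powR_shift_right|exact: cvg_powR_shift_right].
    by apply: cvg_at_right_filter; exact: cvg_id.
  + apply: cvg_g; apply: cvg_at_left_filter; first exact: cvg_id.
      by apply: continuous_powR_shift; lra.
    by apply: continuous_powR_shift; lra.
- by rewrite in_itv/= x0 (le_trans xy).
- by rewrite in_itv/= yh (le_trans x0).
Qed.

(** The right-hand side is the increment of a primitive of the tangent at [m]
    of the derivative [(1+c) x^c]; that derivative is concave, so it lies below
    the tangent. *)
Lemma powR_le_tangent_primitive (R : realType) (c m x y : R) :
  0 <= c <= 1 -> 0 < m -> 0 <= x <= y ->
  y `^ (1 + c) - x `^ (1 + c) <=
  (1 + c) * ((1 - c) * m `^ c * (y - x)
             + c / 2 * m `^ (c - 1) * (y ^+ 2 - x ^+ 2)).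
Proof.
move=> c01 m0 /andP[x0 xy]; have /andP[c0 c1] := c01.
have dg (z : R) : 0 < z < y -> 0 <= (1 + c) * (0 * (z + 0) `^ c + -1 * z `^ c)
    + (1 + c) * (1 - c) * m `^ c + (1 + c) * c * m `^ (c - 1) * z.
  move=> /andP[z0 _].
  have tg := powR_tangent c01 m0 (ltW z0).
  rewrite (_ : _ + _ =
    (1 + c) * (m `^ c + c * m `^ (c - 1) * (z - m) - z `^ c)).
    by apply: mulr_ge0; lra.
  by rewrite -(gt0_mulr_powRB1 c m0); ring.
have := powR_comb_le (lexx 0) c0 dg x0 xy (lexx y).
lra.
Qed.

(** Subadditivity of [x^c] bounds each increment of the derivative over a step
    [p] by the value of the derivative at [p]. *)
Lemma powR_second_diff_le (R : realType) (c d p r : R) :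
  0 <= c <= 1 -> 0 <= d -> 0 <= p -> 0 <= r ->
  (d + p + r) `^ (1 + c) - (d + p) `^ (1 + c) - (d + r) `^ (1 + c)
    + d `^ (1 + c) <= (1 + c) * r * p `^ c.
Proof.
move=> c01 d0 p0 r0; have /andP[c0 c1] := c01.
have dg (z : R) : 0 < z < d + r -> 0 <= (1 + c) * (-1 * (z + p) `^ c + 1 * z `^ c)
    + (1 + c) * p `^ c + 0 * z.
  move=> /andP[z0 _].
  have sa := powR_subadditive c01 z0 p0; rewrite (addrC p) in sa.
  rewrite (_ : _ + _ = (1 + c) * (p `^ c + z `^ c - (z + p) `^ c)).
    by apply: mulr_ge0; lra.
  by ring.
have ddr : d <= d + r by lra.
have := powR_comb_le p0 c0 dg d0 ddr (lexx _).
rewrite (addrAC d r p); lra.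
Qed.

(** The second derivative [(1+c) c x^(c-1)] is nonincreasing, so its smallest
    value on the range of the second difference is at the right end. *)
Lemma powR_second_diff_ge (R : realType) (c d p r : R) :
  0 <= c <= 1 -> 0 <= d -> 0 <= p -> 0 <= r ->
  (1 + c) * c * p * r * (d + p + r) `^ (c - 1) <=
  (d + p + r) `^ (1 + c) - (d + p) `^ (1 + c) - (d + r) `^ (1 + c)
    + d `^ (1 + c).
Proof.
move=> c01 d0 p0 r0; have /andP[c0 c1] := c01.
set K := (d + p + r) `^ (c - 1).
have dg (z : R) : 0 < z < d + r -> 0 <= (1 + c) * (1 * (z + p) `^ c + -1 * z `^ c)
    + - ((1 + c) * c * p * K) + 0 * z.
  move=> /andP[z0 zr].
  have zp0 : 0 < z + p by lra.
  have tg := powR_tangent c01 zp0 (ltW z0).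
  have KZ : K <= (z + p) `^ (c - 1) by apply: le0_ger_powR; lra.
  have : c * p * K <= c * p * (z + p) `^ (c - 1).
    by apply: ler_wpM2l => //; apply: mulr_ge0.
  rewrite (_ : _ + _ = (1 + c) * ((z + p) `^ c - z `^ c - c * p * K)); last first.
    by ring.
  by move=> ?; apply: mulr_ge0; lra.
have ddr : d <= d + r by lra.
have := powR_comb_le p0 c0 dg d0 ddr (lexx _).
rewrite (addrAC d r p); lra.
Qed.

(** * The inequality for four numbers *)

Lemma mul_half_powRB1 (R : realType) (c b : R) : 0 < b ->
  b * (b / 2) `^ (c - 1) = 2 * (b / 2) `^ c.
Proof.
move=> b0; have m0 : 0 < b / 2 by lra.
by rewrite -(gt0_mulr_powRB1 c m0); field.
Qed.

(** The tangent at [b/2] is the right one because there the two bounds, [2s] on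
    [X] and [2bs] on [Y], weigh in exactly the ratio [1-c] to [c]. *)
Lemma tangent_budget (R : realType) (c b s X Y : R) : 0 <= c <= 1 -> 0 < b ->
  X <= 2 * s -> Y <= 2 * b * s ->
  (1 + c) * ((1 - c) * (b / 2) `^ c * X + c / 2 * (b / 2) `^ (c - 1) * Y) <=
  2 * (1 + c) * s * (b / 2) `^ c.
Proof.
move=> /andP[c0 c1] b0 Xs Ybs.
have hb := mul_half_powRB1 c b0.
rewrite (_ : 2 * (1 + c) * s * _ = (1 + c) * ((1 - c) * (b / 2) `^ c * (2 * s)
  + c / 2 * (b / 2) `^ (c - 1) * (2 * b * s))); last first.
  transitivity ((1 + c) * ((1 - c) * (b / 2) `^ c * (2 * s)
    + c * s * (b * (b / 2) `^ (c - 1)))); last by field.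
  by rewrite hb; ring.
apply: ler_wpM2l; first lra.
by apply: lerD; apply: ler_wpM2l => //; rewrite ?mulr_ge0 ?powR_ge0//; lra.
Qed.

Lemma aligned_bound (R : realType) (c A B C D b s : R) :
  0 <= c <= 1 -> 0 < b -> 0 <= B <= A -> 0 <= C <= D -> A - B - C + D <= 2 * s ->
  A ^+ 2 - B ^+ 2 - C ^+ 2 + D ^+ 2 <= 2 * b * s ->
  A `^ (1 + c) - B `^ (1 + c) - C `^ (1 + c) + D `^ (1 + c) <=
  2 * (1 + c) * s * (b / 2) `^ c.
Proof.
move=> c01 b0 BA CD hX hY; have m0 : 0 < b / 2 by lra.
apply: le_trans (tangent_budget c01 b0 hX hY).
have := powR_le_tangent_primitive c01 m0 BA.
have := powR_le_tangent_primitive c01 m0 CD.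
lra.
Qed.

(** [A] is the largest and [D] the smallest number.  If
    [A+D-B-C] is positive, the mixed difference is the second difference at [D]
    with steps [B-D] and [C-D] plus the increment of [f] over the last
    [A+D-B-C] below [A], which the tangent primitive controls.  Otherwise
    [D+(A-B) <= C], and the second difference at [D] with steps [B-D] and [A-B]
    is already an upper bound. *)
Lemma outer_positive_bound (R : realType) (c A B C D b s : R) :
  0 <= c <= 1 -> 0 < b -> 0 <= D -> D <= B <= A -> D <= C <= A ->
  A - B <= s -> B - D <= b ->
  A ^+ 2 - B ^+ 2 - C ^+ 2 + D ^+ 2 <= 2 * b * s ->
  A `^ (1 + c) - B `^ (1 + c) - C `^ (1 + c) + D `^ (1 + c) <=
  2 * (1 + c) * s * (b / 2) `^ c.
Proof.
move=> c01 b0 D0 /andP[DB BA] /andP[DC CA] As Bb hY.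
have /andP[c0 c1] := c01; have m0 : 0 < b / 2 by lra.
have be0 : 0 <= B - D by lra.
have tg : (B - D) `^ c <=
    (1 - c) * (b / 2) `^ c + c * (b / 2) `^ (c - 1) * (B - D).
  by apply: le_trans (powR_tangent c01 m0 be0) _; rewrite -(gt0_mulr_powRB1 c m0); lra.
have SD ga : 0 <= ga -> (B + ga) `^ (1 + c) - B `^ (1 + c) - (D + ga) `^ (1 + c)
    + D `^ (1 + c) <= (1 + c) * ((1 - c) * (b / 2) `^ c * ga
      + c / 2 * (b / 2) `^ (c - 1) * (2 * ga * (B - D))).
  move=> ga0; have := powR_second_diff_le c01 D0 be0 ga0.
  rewrite (subrKC D B) => h; apply: (le_trans h).
  have : 0 <= (1 + c) * ga by rewrite mulr_ge0//; lra.
  by move=> /ler_wpM2l /(_ _ _ tg) h2; apply: (le_trans h2); lra.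
have [d0|/ltW d0] := leP (A + D) (B + C).
- have u0 : 0 <= A - B by lra.
  have hX : A - B <= 2 * s by lra.
  have hY' : 2 * (A - B) * (B - D) <= 2 * b * s.
    have : (A - B) * (B - D) <= s * b by apply: ler_pM.
    lra.
  apply: le_trans (tangent_budget c01 b0 hX hY'); have := SD _ u0.
  rewrite subrKC.
  have : (D + (A - B)) `^ (1 + c) <= C `^ (1 + c).
    by apply: ge0_ler_powR; rewrite ?nnegrE; lra.
  lra.
- have g0 : 0 <= C - D by lra.
  have hX : A - B <= 2 * s by lra.
  apply: le_trans (tangent_budget c01 b0 hX hY); have := SD _ g0.
  rewrite subrKC.
  have AE : 0 <= B + (C - D) <= A by lra.
  have := powR_le_tangent_primitive c01 m0 AE.
  lra.
Qed.

(** The numerical heart of the case where [B] and [C] are the extreme values.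
    There [dl] is the defect [A+D-B-C], [N] the midpoint of [[B, B+dl]] and
    [T = (C-A)(C-D)].  With [e = 1-c] and [W = N^(-e)], bounding [C^(-e)] by its
    tangent at [N] and using [T >= dl N - b s] leaves
    [W (b s + e (1 + 2b/N) (dl N - b s))], and the two bounds on [T] together
    give [dl <= 2 b s / (N+b)].  What remains is
    [1 + e (1 - 2/(r(r+1))) <= (2r)^e] for [r = N/b >= 1]. *)
Lemma outer_negative_core (R : realType) (c b s N C dl T : R) : 0 <= c <= 1 ->
  0 < b -> b <= N -> 0 < C -> C <= N + 2 * b -> 0 <= s ->
  b * s <= dl * N -> dl * N - b * s <= T -> T <= b * (s - dl) ->
  dl * N `^ c - c * T * C `^ (c - 1) <= 2 * s * (b / 2) `^ c.
Proof.
move=> /andP[c0 c1] b0 bN C0 CN s0 G0 GT Tb.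
have N0 : 0 < N by lra.
set e := 1 - c; have e0 : 0 <= e by rewrite /e; lra.
have ce : c - 1 = - e by rewrite /e; ring.
set W := N `^ (c - 1); have W0 : 0 <= W by exact: powR_ge0.
set G := dl * N - b * s; have G0' : 0 <= G by rewrite /G; lra.
set q := 1 - e * (2 * b / N).
have CW : W * q <= C `^ (c - 1).
  rewrite /W ce; apply: le_trans (powR_ratio_ge e0 N0 C0).
  apply: ler_wpM2l; first exact: powR_ge0.
  rewrite /q lerD2l lerN2; apply: ler_wpM2l => //.
  rewrite lerBlDr -[X in _ <= _ + X](divff (lt0r_neq0 N0)) -mulrDl.
  by rewrite ler_pM2r ?invr_gt0; lra.
(* [c q >= 1 - e (1 + 2b/N)]: the dropped term is [e^2 (2b/N)] *)
have TC : (1 - e * (1 + 2 * b / N)) * G * W <= c * T * C `^ (c - 1).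
  have Tpos : 0 <= T by lra.
  apply: (@le_trans _ _ (c * G * C `^ (c - 1))); last first.
    by apply: ler_wpM2r; [exact: powR_ge0|apply: ler_wpM2l].
  apply: (@le_trans _ _ (c * G * (W * q))); last first.
    by apply: ler_wpM2l => //; apply: mulr_ge0.
  rewrite (_ : c * G * (W * q) = (c * q) * G * W); last by ring.
  do 2 (apply: ler_wpM2r => //).
  have -> : c = 1 - e by rewrite /e; ring.
  have : 0 <= e * e * (2 * b / N) by rewrite !mulr_ge0 ?invr_ge0; lra.
  rewrite /q; lra.
(* the two bounds on [T] squeeze [dl], hence the excess [G] *)
have GN : G * (N + b) <= b * s * (N - b).
  have : dl * (N + b) <= 2 * b * s by lra.
  rewrite /G => h; nra.
have Wb : W * (1 + e * (1 - 2 / (N / b * (N / b + 1)))) <= (b / 2) `^ (c - 1).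
  have r1 : 1 <= N / b by rewrite ler_pdivlMr// mul1r.
  have -> : (b / 2) `^ (c - 1) = W * (2 * (N / b)) `^ e.
    have -> : b / 2 = N / (2 * (N / b)) by field; rewrite !gt_eqF.
    have y0 : 0 <= 2 * (N / b) by lra.
    rewrite powRM ?invr_ge0//; last by lra.
    by rewrite -(powR_inv1 y0) -powRrM /W ce mulrNN mul1r.
  by apply: ler_wpM2l => //; apply: powR_double_ge.
rewrite -(gt0_mulr_powRB1 c N0) -/W.
rewrite [leRHS]mulrAC -mul_half_powRB1//.
apply: (@le_trans _ _ (W * (b * s + G * (e * (1 + 2 * b / N))))).
  by move: TC; rewrite /G; lra.
set q2 := 1 - 2 / (N / b * (N / b + 1)).
apply: (@le_trans _ _ (s * b * (W * (1 + e * q2)))); last first.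
  rewrite [leRHS](_ : _ = s * b * (b / 2) `^ (c - 1)); last by ring.
  by apply: ler_wpM2l => //; apply: mulr_ge0 => //; lra.
rewrite [leRHS](_ : _ = W * (b * s + e * (b * s * q2))); last by ring.
apply: ler_wpM2l => //; rewrite lerD2l mulrCA; apply: ler_wpM2l => //.
rewrite -(ler_pM2r (_ : 0 < N + b)); last by lra.
rewrite [leLHS](_ : _ = G * (N + b) * (1 + 2 * b / N)); last by ring.
apply: (@le_trans _ _ (b * s * (N - b) * (1 + 2 * b / N))).
  apply: ler_wpM2r => //; rewrite addr_ge0// divr_ge0//; lra.
rewrite /q2 le_eqVlt; apply/orP; left; apply/eqP; field.
by rewrite !gt_eqF//; lra.
Qed.

(** [B] is the smallest and [C] the largest number.  If the defect
    [dl = A+D-B-C] is not positive, convexity makes the mixed difference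
    nonpositive.  Otherwise it is the increment of [f] over [[B, B+dl]] minus
    the second difference at [B+dl] with steps [C-A] and [C-D], and the
    hypothesis on squares reads [dl N - (C-A)(C-D) <= b s] for the midpoint
    [N].  If even [dl N <= b s], the second difference may be dropped; if not,
    its lower bound is set against the excess. *)
Lemma outer_negative_bound (R : realType) (c A B C D b s : R) :
  0 <= c <= 1 -> 0 < b -> s <= b -> 0 <= B -> B <= A <= C -> B <= D <= C ->
  A - B <= s -> D - B <= b ->
  A ^+ 2 - B ^+ 2 - C ^+ 2 + D ^+ 2 <= 2 * b * s ->
  A `^ (1 + c) - B `^ (1 + c) - C `^ (1 + c) + D `^ (1 + c) <=
  2 * (1 + c) * s * (b / 2) `^ c.
Proof.
move=> c01 b0 sb B0 /andP[BA AC] /andP[BD DC] As Db hY.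
have /andP[c0 c1] := c01; have m0 : 0 < b / 2 by lra.
have w0 : 0 <= C - D by lra.
have [d0|d0] := leP (A + D) (B + C).
- have v0 : 0 <= D - B by lra.
  have s0 : 0 <= s by lra.
  have := powR_second_diff_ge c01 B0 v0 w0.
  rewrite subrKC subrKC.
  have : 0 <= (1 + c) * c * (D - B) * (C - D) * C `^ (c - 1).
    by rewrite !mulr_ge0 ?powR_ge0//; lra.
  have : A `^ (1 + c) <= (B + (C - D)) `^ (1 + c).
    by apply: ge0_ler_powR; rewrite ?nnegrE; lra.
  have : 0 <= 2 * (1 + c) * s * (b / 2) `^ c.
    by rewrite !mulr_ge0 ?powR_ge0//; lra.
  lra.
set dl := A - B - C + D; set E := B + dl.
have dl0 : 0 < dl by rewrite /dl; lra.
have E0 : 0 <= E by rewrite /E; lra.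
have k0 : 0 <= C - A by lra.
have := powR_second_diff_ge c01 E0 k0 w0.
rewrite (_ : E + (C - A) + (C - D) = C); last by rewrite /E /dl; ring.
rewrite (_ : E + (C - A) = D); last by rewrite /E /dl; ring.
rewrite (_ : E + (C - D) = A); last by rewrite /E /dl; ring.
move=> SD; set N := B + dl / 2.
have N0 : 0 < N by rewrite /N; lra.
have hN : dl * N - (C - A) * (C - D) <= b * s.
  have : dl * N - (C - A) * (C - D) = (A ^+ 2 - B ^+ 2 - C ^+ 2 + D ^+ 2) / 2.
    by rewrite /N /dl; field.
  lra.
have BE : 0 <= B <= E by rewrite /E; lra.
have [small|/ltW big] := leP (dl * N) (b * s).
- have hX : dl <= 2 * s by rewrite /dl; lra.
  have hY' : 2 * (dl * N) <= 2 * b * s by lra.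
  apply: le_trans (tangent_budget c01 b0 hX hY').
  have SD0 : 0 <= (1 + c) * c * (C - A) * (C - D) * C `^ (c - 1).
    by rewrite !mulr_ge0 ?powR_ge0//; lra.
  have := powR_le_tangent_primitive c01 m0 BE.
  rewrite (_ : E - B = dl); last by rewrite /E; ring.
  rewrite (_ : E ^+ 2 - B ^+ 2 = 2 * (dl * N)); last by rewrite /E /N; field.
  lra.
have dls : dl <= s by rewrite /dl; lra.
have bN : b <= N by rewrite -(ler_pM2l dl0); nra.
have Tb : (C - A) * (C - D) <= b * (s - dl).
  by apply: ler_pM; rewrite /dl; lra.
have C0 : 0 < C by lra.
have CN : C <= N + 2 * b by rewrite /N /dl; lra.
have s0 : 0 <= s by lra.
have Tge : dl * N - b * s <= (C - A) * (C - D) by lra.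
have c10 : 0 <= 1 + c by lra.
have /(ler_wpM2l c10) := outer_negative_core c01 b0 bN C0 CN s0 big Tge Tb.
have := powR_le_tangent_primitive c01 N0 BE.
rewrite (_ : E - B = dl); last by rewrite /E; ring.
rewrite (_ : E ^+ 2 - B ^+ 2 = 2 * dl * N); last by rewrite /E /N; field.
rewrite -(gt0_mulr_powRB1 c N0).
lra.
Qed.

(** Reversing the roles of the two points in each pair maps [(A, B, C, D)] to
    [(D, C, B, A)], which accounts for the mirrored orderings. *)
Lemma four_numbers_ordered (R : realType) (c A B C D b s : R) :
  0 <= c <= 1 -> 0 < b -> 0 <= s <= b ->
  0 <= A -> 0 <= B -> 0 <= C -> 0 <= D ->
  `|A - B| <= s -> `|D - C| <= s -> `|A - C| <= b -> `|D - B| <= b ->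
  A ^+ 2 - B ^+ 2 - C ^+ 2 + D ^+ 2 <= 2 * b * s ->
  A `^ (1 + c) - B `^ (1 + c) - C `^ (1 + c) + D `^ (1 + c) <=
  2 * (1 + c) * s * (b / 2) `^ c.
Proof.
move=> c01 b0 /andP[s0 sb] A0 B0 C0 D0.
rewrite !ler_norml => /andP[? ?] /andP[? ?] /andP[? ?] /andP[? ?] hY.
have /andP[c0 c1] := c01.
have mono x y : 0 <= x -> x <= y -> x `^ (1 + c) <= y `^ (1 + c).
  by move=> x0 xy; apply: ge0_ler_powR; rewrite ?nnegrE; lra.
have RHS0 : 0 <= 2 * (1 + c) * s * (b / 2) `^ c.
  by rewrite !mulr_ge0 ?powR_ge0//; lra.
have [AB|BA] := leP A B; have [DC|CD] := leP D C.
- have := mono _ _ A0 AB; have := mono _ _ D0 DC; lra.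
- have [AC|CA] := leP A C; have [DB|BD] := leP D B.
  + have := mono _ _ A0 AC; have := mono _ _ D0 DB; lra.
  + have := @outer_positive_bound _ c D C B A b s; lra.
  + have := @outer_negative_bound _ c D C B A b s; lra.
  + have := @aligned_bound _ c A C B D b s; lra.
- have [AC|CA] := leP A C; have [DB|BD] := leP D B.
  + have := mono _ _ A0 AC; have := mono _ _ D0 DB; lra.
  + have := @outer_negative_bound _ c A B C D b s; lra.
  + have := @outer_positive_bound _ c A B C D b s; lra.
  + have := @aligned_bound _ c A C B D b s; lra.
- have := @aligned_bound _ c A B C D b s; lra.
Qed.

(** The hypotheses are invariant under exchanging [B] with [C] and [s] with [b],
    and the exchanged bound is the stronger one when [b < s]. *)
Lemma four_numbers (R : realType) (c A B C D b s : R) :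
  0 <= c <= 1 -> 0 < b -> 0 <= s ->
  0 <= A -> 0 <= B -> 0 <= C -> 0 <= D ->
  `|A - B| <= s -> `|D - C| <= s -> `|A - C| <= b -> `|D - B| <= b ->
  A ^+ 2 - B ^+ 2 - C ^+ 2 + D ^+ 2 <= 2 * b * s ->
  A `^ (1 + c) - B `^ (1 + c) - C `^ (1 + c) + D `^ (1 + c) <=
  2 * (1 + c) * s * (b / 2) `^ c.
Proof.
move=> c01 b0 s0 A0 B0 C0 D0 AB DC AC DB hY.
have /andP[c0 c1] := c01.
have [sb|bs] := leP s b; first by apply: four_numbers_ordered; rewrite ?s0.
have sp : 0 < s by lra.
have /le_trans : A `^ (1 + c) - B `^ (1 + c) - C `^ (1 + c) + D `^ (1 + c) <=
    2 * (1 + c) * b * (s / 2) `^ c.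
  rewrite (addrAC (A `^ _)); apply: four_numbers_ordered => //; last by lra.
  by rewrite ltW//= ltW.
apply.
have m0 : 0 < b / 2 by lra.
have n0 : 0 < s / 2 by lra.
rewrite -(gt0_mulr_powRB1 c m0) -(gt0_mulr_powRB1 c n0).
have -> : 2 * (1 + c) * b * (s / 2 * (s / 2) `^ (c - 1)) =
  (1 + c) * b * s * (s / 2) `^ (c - 1) by field.
have -> : 2 * (1 + c) * s * (b / 2 * (b / 2) `^ (c - 1)) =
  (1 + c) * b * s * (b / 2) `^ (c - 1) by field.
apply: ler_wpM2l; first by rewrite !mulr_ge0//; lra.
by apply: le0_ger_powR; lra.
Qed.

(** * Transfer to the metric space *)

Lemma mdist_lip (R : realType) (Q : metricType R) (x q p : Q) :
  `|mdist x q - mdist x p| <= mdist q p.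
Proof.
have := metric_triangle x p q; have := metric_triangle x q p.
rewrite (metric_sym p q) ler_norml; lra.
Qed.

Theorem theorem3 (R : realType) (Q : metricType R) (q p y z : Q) (a : R)
  (ha : 1 / 2 <= a <= 1)
  (hquad : mdist y q ^+ 2 - mdist y p ^+ 2 - mdist z q ^+ 2 + mdist z p ^+ 2
           <= 2 * mdist y z * mdist q p) :
  mdist y q `^ (2 * a) - mdist y p `^ (2 * a)
    - mdist z q `^ (2 * a) + mdist z p `^ (2 * a)
  <= 8 * a * 2 `^ (- (2 * a)) * mdist y z `^ (2 * a - 1) * mdist q p.
Proof.
have [yz|yz] := eqVneq y z.
  rewrite yz (_ : _ + _ = 0); last by ring.
  by rewrite !mulr_ge0 ?powR_ge0 ?mdist_ge0//; lra.
pose c := 2 * a - 1; have c01 : 0 <= c <= 1 by rewrite /c; lra.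
have b0 : 0 < mdist y z by rewrite mdist_gt0.
have -> : 8 * a * 2 `^ (- (2 * a)) * mdist y z `^ (2 * a - 1) * mdist q p =
    2 * (1 + c) * mdist q p * (mdist y z / 2) `^ c.
  rewrite powRM ?(ltW b0) ?invr_ge0// -powR_inv1// -powRrM mulN1r.
  have -> : - (2 * a) = - c - 1 by rewrite /c; ring.
  rewrite powRB; last by apply/implyP => _; rewrite gt_eqF.
  by rewrite powRr1// /c; field.
rewrite (_ : 2 * a = 1 + c); last by rewrite /c; ring.
apply: four_numbers; rewrite ?mdist_ge0//.
- exact: mdist_lip.
- by rewrite distrC mdist_lip.
- by rewrite (metric_sym y q) (metric_sym z q) mdist_lip.
- by rewrite (metric_sym y p) (metric_sym z p) distrC mdist_lip.
Qed.
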